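(* Let $\mathbb{F}_q$ be a finite field, let $m\ge 1$, and let $\Gamma=\{p_1,\dots,p_n\}\subset\mathbb{P}^m$ be a reduced complete intersection of $m$ hypersurfaces of degrees $d_1,d_2,\dots,d_m$ defined over $\mathbb{F}_q$, all of whose points are $\mathbb{F}_q$-rational. Put $s=\left(\sum_{i=1}^m d_i\right)-m-1$. If $a$ is an integer with $1\le a\le s$, then the evaluation code $C(\Gamma)_a$ has minimum distance $$d\ \ge\ \left(\sum_{i=1}^m d_i\right)-a-(m-1)\ =\ s-a+2 .$$
   Context: Let $R=\mathbb{F}_q[x_0,\dots,x_m]$ and let $R_a$ be the vector space of homogeneous polynomials of degree $a$ in $R$. A finite set $\Gamma\subset\mathbb{P}^m$ is a reduced complete intersection of hypersurfaces of degrees $d_1,\dots,d_m$ if there are homogeneous $F_i\in R$ of degree $d_i\geq 1$ ($1\le i\le m$) such that the ideal $\langle F_1,\dots,F_m\rangle$ defines $\Gamma$ as a reduced zero-dimensional scheme (so the $F_i$ have exactly $d_1d_2\cdots d_m$ distinct common zeros, namely the points of $\Gamma$, and $n=|\Gamma|=d_1\cdots d_m$). Evaluation code: given a set $\Gamma=\{p_1,\dots,p_n\}$ of $\mathbb{F}_q$-rational points of $\mathbb{P}^m$ and a degree $a$, choose $f_0\in R_a$ with $f_0(p_i)\ne 0$ for all $i$ (such an $f_0$ is assumed to exist). Then $C(\Gamma)_a\subset\mathbb{F}_q^n$ is the image of the linear map $R_a\to\mathbb{F}_q^n$, $f\mapsto\left(\frac{f(p_1)}{f_0(p_1)},\dots,\frac{f(p_n)}{f_0(p_n)}\right)$.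 The minimum distance $d$ of $C(\Gamma)_a$ is the minimum, over all nonzero codewords, of the number of nonzero entries. *)

(* Defs.v *)
From HB Require Import structures.
From mathcomp Require Import all_boot all_order all_algebra.
From mathcomp Require Export mpoly.

Set Implicit Arguments.
Unset Strict Implicit.
Unset Printing Implicit Defensive.

Import Order.TTheory GRing.Theory Num.Theory.
Local Open Scope ring_scope.

Section ProjectivePoints.
Variables (K : fieldType) (m : nat).

(* The value of a form at a representative of a point of P^m.  Only the       *)
(* vanishing of forms, and quotients of two forms of the same degree, are     *)
(* independent of the representative.                                         *)
Definition evalp (v : 'rV[K]_m.+1) (f : {mpoly K[m.+1]}) : K :=
  f.@[fun j => v 0 j].

Definition same_point (u v : 'rV[K]_m.+1) : Prop :=
  exists2 c : K, c != 0 & v = c *: u.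

(* p lists homogeneous coordinates of n pairwise distinct K-rational points.  *)
Definition proj_points (n : nat) (p : 'I_n -> 'rV[K]_m.+1) : Prop :=
  (forall i, p i != 0) /\ (forall i j, same_point (p i) (p j) -> i = j).

Definition vanishes_on (n : nat) (p : 'I_n -> 'rV[K]_m.+1)
  (f : {mpoly K[m.+1]}) : Prop := forall i, evalp (p i) f = 0.

Definition in_ideal (r : nat) (G : 'I_r -> {mpoly K[m.+1]})
  (f : {mpoly K[m.+1]}) : Prop :=
  exists h : 'I_r -> {mpoly K[m.+1]}, f = \sum_i h i * G i.

(* Saturation with respect to the irrelevant ideal: f becomes a member of the *)
(* ideal in each localization at a variable, i.e., on each standard chart.    *)
Definition in_saturation (r : nat) (G : 'I_r -> {mpoly K[m.+1]})
  (f : {mpoly K[m.+1]}) : Prop :=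
  forall j : 'I_m.+1, exists N : nat, in_ideal G ('X_j ^+ N * f).

(* Two homogeneous ideals define the same closed subscheme of P^m iff they    *)
(* have the same saturation, and the homogeneous ideal of a set of points     *)
(* with its reduced structure is saturated.  This is an equality of schemes   *)
(* over K, so V(G) has no point outside p, even over an algebraic closure.    *)
Definition defines_reduced (r : nat) (G : 'I_r -> {mpoly K[m.+1]})
  (n : nat) (p : 'I_n -> 'rV[K]_m.+1) : Prop :=
  forall (k : nat) (f : {mpoly K[m.+1]}), f \is k.-homog ->
    (in_saturation G f <-> vanishes_on p f).

(* The equality n = \prod_i d i is a consequence (Bezout), not a clause.      *)
Definition reduced_complete_intersection (d : 'I_m -> nat)
  (n : nat) (p : 'I_n -> 'rV[K]_m.+1) : Prop :=
  (forall i, (1 <= d i)%N) /\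
  exists G : 'I_m -> {mpoly K[m.+1]},
    (forall i, G i \is (d i).-homog) /\ defines_reduced G p.

End ProjectivePoints.

Section EvaluationCode.
Variables (K : fieldType) (m a n : nat).
Variables (p : 'I_n -> 'rV[K]_m.+1) (f0 : {mpoly K[m.+1]}).

Definition eval_word (f : dhomog m.+1 K a) : 'rV[K]_n :=
  \row_i (evalp (p i) f / evalp (p i) f0).

Fact eval_word_is_linear : linear eval_word.
Proof.
move=> c f g; apply/rowP => i; rewrite !mxE /evalp.
by rewrite linearP /= mulrDl mulrA.
Qed.

HB.instance Definition _ :=
  GRing.isLinear.Build K (dhomog m.+1 K a) 'rV[K]_n _ eval_word
    eval_word_is_linear.

Definition eval_code : {vspace 'rV[K]_n} := limg (linfun eval_word).

Lemma eval_codeP (c : 'rV[K]_n) :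
  reflect (exists f : dhomog m.+1 K a, c = eval_word f) (c \in eval_code).
Proof.
apply: (iffP memv_imgP) => [[f _ ->]|[f ->]].
  by exists f; rewrite lfunE.
by exists f; rewrite ?memvf ?lfunE.
Qed.

End EvaluationCode.

Arguments eval_code {K m} a {n} p f0.

Section MinimumDistance.
Variables (K : finFieldType) (n : nat).

Definition weight (c : 'rV[K]_n) : nat := #|[set i | c 0 i != 0]|.

Lemma weight_le (c : 'rV[K]_n) : (weight c <= n)%N.
Proof. by rewrite (leq_trans (max_card _)) ?card_ord. Qed.

(* As no weight exceeds n, the default value n affects only the zero code.    *)
Definition min_distance (C : {vspace 'rV[K]_n}) : nat :=
  \big[minn/n]_(c : 'rV[K]_n | (c \in C) && (c != 0)) weight c.

Lemma min_distanceP (C : {vspace 'rV[K]_n}) : C != 0%VS ->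
  (exists c, [/\ c \in C, c != 0 & weight c = min_distance C]) /\
  (forall c, c \in C -> c != 0 -> (min_distance C <= weight c)%N).
Proof.
move=> C0; have minE : min_distance C =
    \big[Order.min/n]_(c | (c \in C) && (c != 0)) weight c.
  by apply: (big_rec2 (fun x y : nat => x = y)) => // c x y _ ->;
     rewrite minEnat.
have vC : (vpick C \in C) && (vpick C != 0) by rewrite memv_pick vpick0.
split=> [|c cC c0].
  have [c /andP[cC c0] cE] :=
    eq_bigmin (vpick C) (fun c => (c \in C) && (c != 0)) weight vC
      (fun c _ => weight_le c).
  by exists c; split; rewrite // minE cE.
by rewrite minE -leEnat; apply: bigmin_le_cond; rewrite cC.
Qed.

End MinimumDistance.

(* Main.v *)
Require Import Defs.
From mathcomp Require Import all_boot all_order all_algebra.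
From mathcomp Require Import perm finfield ring zify.
Set Implicit Arguments.
Unset Strict Implicit.
Unset Printing Implicit Defensive.
Import Order.TTheory GRing.Theory Num.Theory.
Local Open Scope ring_scope.

(** The key fact is a Cayley-Bacharach property.  Write sigma for the sum of
    the d_i - 1.  A form g of degree smaller than sigma that vanishes at all
    points of Gamma but one, say at all but P, vanishes at P as well.

    This bounds the minimum distance.  Suppose that f has degree a and is
    nonzero at exactly w points of Gamma, P among them.  For each of the w - 1
    others choose a linear form that vanishes there but not at P.  The product
    of f with these forms has degree a + w - 1 and is nonzero at P only, so
    a + w - 1 >= sigma, that is, w >= s - a + 2.

    The Cayley-Bacharach property rests on a fact about determinants.  Let
    F_0, ..., F_m be forms in x_0, ..., x_m whose ideal contains a power of
    each variable, and write F = A x for a square matrix A.  Then det A is not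
    in the ideal (F) ([det_notin_ideal]).  Indeed, express the powers of the
    variables through F, as x^N = C F = (C A) x.  If det A were in (F), then
    det C det A would be in the ideal of the powers x_j^(N_j), by Cramer's rule
    applied to C.  But det (C A) contains the monomial with exponents N_j - 1
    ([mcoeff_det_powers]), as the diagonal matrix with entries x_j^(N_j - 1)
    does.

    To apply this, let G_1, ..., G_m define Gamma and let x_z be nonzero at P.
    The linear forms y_j = x_j - (P_j / P_z) x_z cut out P, so G = A y for an
    m by m matrix A of forms.  Its determinant Delta has degree sigma.  As
    Delta y_j is in (G), Delta vanishes on Gamma outside P.  If g(P) is not 0,
    then Delta - c g x_z^k vanishes on Gamma for some scalar c, where
    k = sigma - deg g > 0.  Now take a power L of f_0, of degree b, that takes
    the value 1 at all the chosen coordinate vectors of Gamma; this is possible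
    for arbitrarily large b because K is finite.  The forms L, G_1, ..., G_m
    have no common zero.  The determinant attached to them is, up to a scalar,
    x_z^(b-1) Delta, and this form equals
      x_z^(b-1) (Delta - c g x_z^k) + c x_z^(k-1) g (x_z^b - L)
        + c x_z^(k-1) g L.
    The second factor of the middle term vanishes at P, so that this term is a
    combination of the y_j g, which vanish on Gamma.  A form that vanishes on
    Gamma lies in (G) after multiplication with any form of large degree
    ([in_saturation_high_degree]), so for large b the first two terms are in
    (G), and the sum is in (L, G).  This contradicts [det_notin_ideal]. *)

(** * Ideals generated by a finite family *)

Section Ideals.
Variables (K : fieldType) (m r : nat) (G : 'I_r -> {mpoly K[m.+1]}).

Lemma in_idealD f g : in_ideal G f -> in_ideal G g -> in_ideal G (f + g).
Proof.
move=> [h ->] [h' ->]; exists (fun i => h i + h' i).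
by rewrite -big_split; apply: eq_bigr => i _; rewrite mulrDl.
Qed.

Lemma in_idealMl q f : in_ideal G f -> in_ideal G (q * f).
Proof.
move=> [h ->]; exists (fun i => q * h i).
by rewrite mulr_sumr; apply: eq_bigr => i _; rewrite mulrA.
Qed.

Lemma in_ideal_sum (I : Type) (s : seq I) (P : pred I) f :
  (forall i, P i -> in_ideal G (f i)) -> in_ideal G (\sum_(i <- s | P i) f i).
Proof.
move=> Gf; apply: big_ind => //; last exact: in_idealD.
by exists (fun=> 0); rewrite big1 // => i _; rewrite mul0r.
Qed.

Lemma in_ideal_gen i : in_ideal G (G i).
Proof.
exists (fun j => (j == i)%:R); rewrite (bigD1 i) //= eqxx mul1r big1 ?addr0 //.
by move=> j /negbTE->; rewrite mul0r.
Qed.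

Lemma in_ideal_trans k (H : 'I_k -> {mpoly K[m.+1]}) f :
  (forall i, in_ideal G (H i)) -> in_ideal H f -> in_ideal G f.
Proof.
by move=> GH [h ->]; apply: in_ideal_sum => i _; apply: in_idealMl.
Qed.

Lemma in_saturation_gen i : in_saturation G (G i).
Proof. by move=> j; exists 0%N; rewrite mul1r; apply: in_ideal_gen. Qed.

End Ideals.

(** * A determinant outside a zero-dimensional ideal *)

Section Determinants.
Variables (K : fieldType) (m : nat).
Notation P := {mpoly K[m.+1]}.

Lemma mcoeff_mulXn0 (q : P) j N (t : 'X_{1..m.+1}) :
  (t j < N)%N -> (q * 'X_j ^+ N)@_t = 0.
Proof.
move=> tN; rewrite mpolyXn; apply: memN_msupp_eq0.
rewrite (perm_mem (msuppMX q _)); apply: contraL tN => /mapP[u _ ->].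
by rewrite mnmDE mulmnE mnm1E eqxx mul1n -leqNgt leq_addr.
Qed.

Lemma cramer n (A : 'M[P]_n) (u : 'I_n -> P) j :
  \det A * u j = \sum_i \adj A j i * \sum_k A i k * u k.
Proof.
have /colP/(_ j) : \adj A *m (A *m \col_k u k) = (\det A)%:M *m \col_k u k.
  by rewrite mulmxA mul_adj_mx.
rewrite mul_scalar_mx !mxE => <-.
apply: eq_bigr => i _; rewrite [(A *m _) i 0]mxE.
by congr (_ * _); apply: eq_bigr => k _; rewrite mxE.
Qed.

(** The diagonal matrix with entries x_i^(N_i) is one solution B, with
    determinant the monomial in question.  Any other solution is reached by
    changing one row at a time.  A change in row i alters the determinant by
    det B2, where B2 x has entry 0 at i and x_k^(N_k + 1) at k != i.  By
    Cramer's rule x_i det B2 is in the ideal of these powers, and the monomial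
    below, multiplied by x_i, is divisible by none of them. *)
Lemma mcoeff_det_powers (N : 'I_m.+1 -> nat) (B : 'M[P]_m.+1) :
  (forall i, \sum_j B i j * 'X_j = 'X_i ^+ (N i).+1) ->
  (\det B)@_[multinom N i | i < m.+1] = 1.
Proof.
set e := [multinom _ | _ < _].
pose Dg : 'M[P]_m.+1 := diag_mx (\row_j 'X_j ^+ N j).
(* t counts the rows in which B may differ from the diagonal matrix. *)
suff main t : forall B : 'M[P]_m.+1,
    (forall i, \sum_j B i j * 'X_j = 'X_i ^+ (N i).+1) ->
    (forall i : 'I_m.+1, (t <= i)%N -> row i B = row i Dg) ->
    (\det B)@_e = 1.
  by move=> BX; apply: (main m.+1) => // i; rewrite leqNgt ltn_ord.
elim: t => [|t IH] {}B BX Bt.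
  have ->: B = Dg by apply/row_matrixP => i; apply: Bt.
  rewrite det_diag (_ : \prod_i _ = 'X_[e]) ?mcoeffX ?eqxx //.
  by rewrite mpolyXE_id; apply: eq_bigr => i _; rewrite mxE mnmE.
have [mt|tm] := leqP m.+1 t.
  by apply: IH => // i ti; have := leq_trans mt ti; rewrite leqNgt ltn_ord.
pose i0 := Ordinal tm.
pose B1 := \matrix_(i, j) (if i == i0 then Dg i j else B i j).
pose B2 := \matrix_(i, j) (if i == i0 then B i j - Dg i j else B i j).
have DgX i : \sum_j Dg i j * 'X_j = 'X_i ^+ (N i).+1.
  rewrite (bigD1 i) //= big1 => [|j ji].
    by rewrite addr0 !mxE eqxx mulr1n exprSr.
  by rewrite !mxE eq_sym (negbTE ji) mulr0n mul0r.
have -> : \det B = 1 * \det B1 + 1 * \det B2.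
  apply: (@determinant_multilinear _ _ _ _ _ i0).
  - by apply/rowP => j; rewrite !mxE eqxx !mul1r addrC subrK.
  - by apply/matrixP => i j; rewrite !mxE eq_sym (negbTE (neq_lift _ _)).
  - by apply/matrixP => i j; rewrite !mxE eq_sym (negbTE (neq_lift _ _)).
rewrite !mul1r mcoeffD IH ?[X in _ + X](_ : _ = 0) ?addr0 //; first last.
- move=> i ti; apply/rowP => j; rewrite !mxE.
  case: eqVneq => [->//|ne].
  have /rowP/(_ j) : row i B = row i Dg.
    apply: Bt; rewrite ltn_neqAle ti andbT; apply: contraNneq ne => ti'.
    exact/eqP/val_inj.
  by rewrite !mxE.
- move=> i; case: (eqVneq i i0) => [->|ne].
    by rewrite -DgX; apply: eq_bigr => j _; rewrite mxE eqxx.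
  by rewrite -BX; apply: eq_bigr => j _; rewrite mxE (negbTE ne).
- rewrite -(mcoeffMX _ U_(i0)%MM) (cramer B2 (fun k => 'X_k)) raddf_sum.
  rewrite big1 //= => i _.
  have [->|ne] := eqVneq i i0.
    rewrite (_ : \sum_k _ = 0) ?mulr0 ?mcoeff0 //.
    rewrite (eq_bigr (fun k => B i0 k * 'X_k - Dg i0 k * 'X_k)) => [|k _].
      by rewrite sumrB BX DgX subrr.
    by rewrite mxE eqxx mulrBl.
  rewrite (_ : \sum_k _ = 'X_i ^+ (N i).+1).
    apply: mcoeff_mulXn0; rewrite mnmDE mnm1E mnmE.
    by rewrite eq_sym (negbTE ne) add0n.
  by rewrite -BX; apply: eq_bigr => k _; rewrite mxE (negbTE ne).
Qed.

(** The hypothesis that 1 is in the saturation says that the ideal contains a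
    power of each variable.  If C expresses these powers through F, then
    multiplication by det C maps the ideal (F) into the ideal of the powers, so
    det A in (F) would contradict [mcoeff_det_powers] for C A. *)
Lemma det_notin_ideal (F : 'I_m.+1 -> P) (A : 'M[P]_m.+1) :
  (forall i, F i = \sum_j A i j * 'X_j) ->
  in_saturation F 1 -> ~ in_ideal F (\det A).
Proof.
move=> FA /fin_all_exists[N NF] [h detE].
(* N j may be 0, so one more power is taken; the exponents N j then give the
   monomial of mcoeff_det_powers. *)
have [C CF] : exists C : 'I_m.+1 -> 'I_m.+1 -> P,
    forall j, 'X_j ^+ (N j).+1 = \sum_i C j i * F i.
  apply: (@fin_all_exists _ _ (fun j c => 'X_j ^+ (N j).+1 = \sum_i c i * F i)).
  by move=> j; rewrite exprS -['X_j ^+ _]mulr1; apply: in_idealMl.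
pose Cm : 'M[P]_m.+1 := \matrix_(i, j) C i j.
have CA i : \sum_j (Cm *m A) i j * 'X_j = 'X_i ^+ (N i).+1.
  rewrite CF (eq_bigr (fun j => \sum_k C i k * A k j * 'X_j)) => [|j _].
    rewrite exchange_big; apply: eq_bigr => k _; rewrite FA mulr_sumr.
    by apply: eq_bigr => j _; rewrite mulrA.
  by rewrite mxE mulr_suml; apply: eq_bigr => k _; rewrite mxE.
have := mcoeff_det_powers CA; rewrite det_mulmx detE mulr_sumr raddf_sum.
rewrite big1 => [/esym/eqP|i _ /=]; first by rewrite oner_eq0.
rewrite mulrCA (cramer Cm F) mulr_sumr raddf_sum big1 //= => k _; rewrite mulrA.
rewrite (eq_bigr (fun l => C k l * F l)) => [|l _]; last by rewrite mxE.
by rewrite -CF mcoeff_mulXn0 // mnmE.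
Qed.

End Determinants.

(** * Forms, and one form added to m others *)

Section Homogeneous.
Variables (K : fieldType) (m : nat).
Notation P := {mpoly K[m.+1]}.

Lemma dhomogXn (j : 'I_m.+1) k : ('X_j ^+ k : P) \is k.-homog.
Proof. by rewrite mpolyXn dhomogX /= mdegMn mdeg1 mul1n. Qed.

Lemma dhomog_const (f : P) : f \is 0.-homog -> f = (f@_0)%:MP.
Proof.
move=> fh; apply/mpolyP => u; rewrite mcoeffC.
have [<-|u0] := eqVneq 0%MM u; first by rewrite mulr1.
by rewrite mulr0 (dhomog_nemf_coeff fh) // mdeg_eq0 eq_sym.
Qed.

Lemma dhomog_bigsum (I : finType) (k : nat) (f : I -> P) :
  (forall i, f i \is k.-homog) -> \sum_i f i \is k.-homog.
Proof. by move=> fh; apply: rpred_sum => i _. Qed.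

(** The degree of the quotients is what makes determinants of such
    decompositions homogeneous. *)
Lemma dhomog_split k (f : P) : f \is k.+1.-homog ->
  exists2 q : 'I_m.+1 -> P,
    forall j, q j \is k.-homog & f = \sum_j q j * 'X_j.
Proof.
move=> /dhomogP fh; rewrite [f]mpolyE big_seq.
apply: (big_ind (fun g : P => exists2 q : 'I_m.+1 -> P,
   forall j, q j \is k.-homog & g = \sum_j q j * 'X_j)) => [|g g'|u uf].
- exists (fun=> 0) => [j|]; first exact: dhomog0.
  by rewrite big1 // => j _; rewrite mul0r.
- move=> [q qh ->] [q' qh' ->]; exists (fun j => q j + q' j) => [j|].
    exact: dhomogD.
  by rewrite -big_split; apply: eq_bigr => j _; rewrite mulrDl.
have uk := fh _ uf.
have [j uj] : exists j, u j != 0%N.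
  apply/existsP; apply: contraPT uk => /existsPn u0.
  rewrite /= mdegE big1 // => j _.
  by apply/eqP; rewrite -[_ == _]negbK.
exists (fun i => if i == j then f@_u *: 'X_[u - U_(j)] else 0) => [i|].
  case: ifP => _; last exact: dhomog0.
  apply: dhomogZ; rewrite dhomogX /= -eqSS -[X in _ == X]uk.
  have := mdegD (u - U_(j)) U_(j); rewrite submK ?lep1mP //= => ->.
  by rewrite mdeg1 addn1.
rewrite (bigD1 j) //= eqxx big1 ?addr0 => [|i /negbTE->]; last by rewrite mul0r.
by rewrite -scalerAl -mpolyXD submK // lep1mP.
Qed.

Lemma dhomog_det n (e : 'I_n -> nat) (A : 'M[P]_n) :
  (forall i j, A i j \is (e i).-homog) -> \det A \is (\sum_i e i).-homog.
Proof.
move=> Ah; apply: dhomog_bigsum => s.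
have Ph : \prod_i A i (s i) \is (\sum_i e i).-homog.
  by apply: (big_ind2 (fun (f : P) k => f \is k.-homog)) => // [|f k f' k'];
    [exact: dhomog1 | exact: dhomogM].
by rewrite mulr_sign; case: ifP => _ //; rewrite dhomogN.
Qed.

(** A monomial of degree larger than the sum of the N_j is divisible by some
    x_j^(N_j).  So one lower bound on the degree serves all multipliers. *)
Lemma in_saturation_high_degree r (G : 'I_r -> P) h : in_saturation G h ->
  exists N, forall k q, (N <= k)%N -> q \is k.-homog -> in_ideal G (q * h).
Proof.
move=> /fin_all_exists[N NG]; exists (\sum_j N j).+1 => k q Nk /dhomogP qh.
rewrite [q]mpolyE big_seq mulr_suml; apply: in_ideal_sum => u /qh uk.
have [j Nj] : exists j, (N j <= u j)%N.
  apply/existsP; apply: contraLR Nk => /existsPn uN.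
  rewrite -leqNgt -uk /= mdegE; apply: leq_sum => j _.
  by rewrite ltnW // ltnNge.
have uE : (u - U_(j) *+ N j + U_(j) *+ N j)%MM = u.
  apply: submK; apply/mnm_lepP => i; rewrite mulmnE mnm1E.
  by case: eqVneq => [<-|_]; rewrite ?mul1n // mul0n.
rewrite -uE mpolyXD -mpolyXn -scalerAl -mulrA scalerAl.
exact: in_idealMl.
Qed.

Definition cons_form (L : P) (G : 'I_m -> P) (i : 'I_m.+1) : P :=
  if unlift ord0 i is Some i' then G i' else L.

Lemma in_ideal_consr L (G : 'I_m -> P) f :
  in_ideal G f -> in_ideal (cons_form L G) f.
Proof.
apply: in_ideal_trans => i.
by have := in_ideal_gen (cons_form L G) (lift ord0 i); rewrite /cons_form liftK.
Qed.

Lemma in_ideal_consl L (G : 'I_m -> P) q : in_ideal (cons_form L G) (q * L).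
Proof.
apply: in_idealMl.
by have := in_ideal_gen (cons_form L G) ord0; rewrite /cons_form unlift_none.
Qed.

(** The matrix that expresses [cons_form] of a combination of the u_j through
    the u_j, see [bordered_mul]. *)
Definition bordered (b : 'I_m.+1 -> P) (A : 'I_m -> 'I_m.+1 -> P) :
  'M[P]_m.+1 :=
  \matrix_(i, j) (if unlift ord0 i is Some i' then A i' j else b j).

Lemma bordered_mul b A (u : 'I_m.+1 -> P) i :
  \sum_j bordered b A i j * u j =
  cons_form (\sum_j b j * u j) (fun i' => \sum_j A i' j * u j) i.
Proof.
rewrite /cons_form; case Ei: (unlift ord0 i) => [i'|];
  by apply: eq_bigr => j _; rewrite mxE Ei.
Qed.

(** If m forms in m + 1 variables had no common zero, the power x_0^(N+1) of a
    variable could be added to them with x_0^N already in their ideal.  The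
    determinant attached to the m + 1 forms is then a multiple of x_0^N,
    against [det_notin_ideal]. *)
Lemma complete_intersection_nonempty (d : 'I_m -> nat) (G : 'I_m -> P) :
  (forall i, 0 < d i)%N -> (forall i, G i \is (d i).-homog) ->
  ~ in_saturation G 1.
Proof.
move=> d_gt0 Gh G1; have [N NG] := G1 ord0; rewrite mulr1 in NG.
have /fin_all_exists[A GA] i :
    exists q : 'I_m.+1 -> P, G i = \sum_j q j * 'X_j.
  have := Gh i; rewrite -(prednK (d_gt0 i)) => /dhomog_split[q _ ->].
  by exists q.
pose b (j : 'I_m.+1) : P := if j == ord0 then 'X_ord0 ^+ N else 0.
pose F := cons_form ('X_ord0 ^+ N.+1) G.
apply: (@det_notin_ideal _ _ F (bordered b A)) => [i|j|].
- rewrite bordered_mul /F /cons_form; case: (unlift _ _) => [i'|] //.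
  rewrite (bigD1 ord0) //= big1 ?addr0 /b => [|j /negbTE->]; last first.
    by rewrite mul0r.
  by rewrite eqxx exprSr.
- by have [k kG] := G1 j; exists k; apply: in_ideal_consr.
- rewrite (expand_det_row _ ord0); apply: in_ideal_sum => j _.
  rewrite mxE unlift_none /b mulrC; case: eqP => _; last first.
    by rewrite mulr0 -(mul0r ('X_ord0 ^+ N)); apply/in_idealMl/in_ideal_consr.
  exact/in_idealMl/in_ideal_consr.
Qed.

Lemma det_bordered b (A : 'I_m -> 'I_m.+1 -> P) z : (forall i, A i z = 0) ->
  \det (bordered b A) =
  b z * ((-1) ^+ z * \det (\matrix_(i, j) A i (lift z j))).
Proof.
move=> Az; rewrite (expand_det_col _ z) (bigD1 ord0) //= big1 ?addr0 => [|i i0].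
  rewrite mxE unlift_none /cofactor add0n; congr (_ * (_ * \det _)).
  by apply/matrixP => i j; rewrite !mxE liftK.
by rewrite mxE; case: unliftP i0 => [i' -> _|-> //]; rewrite Az mul0r.
Qed.

End Homogeneous.

(** * Linear forms through a point *)

Section PointForms.
Variables (K : fieldType) (m : nat).
Notation P := {mpoly K[m.+1]}.
Implicit Types v w : 'rV[K]_m.+1.

Lemma row_nonzero_coord n (v : 'rV[K]_n) : v != 0 -> exists z, v 0 z != 0.
Proof.
move=> v0; apply/existsP; apply: contraNT v0 => /existsPn z0.
by apply/eqP/rowP => z; rewrite mxE; apply/eqP; rewrite -[_ == _]negbK.
Qed.

Lemma evalpM v (f g : P) : evalp v (f * g) = evalp v f * evalp v g.
Proof. exact: mevalM. Qed.

Lemma evalpXn v (f : P) k : evalp v (f ^+ k) = evalp v f ^+ k.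
Proof. exact: rmorphXn. Qed.

Lemma evalpB v (f g : P) : evalp v (f - g) = evalp v f - evalp v g.
Proof. exact: mevalB. Qed.

Lemma evalpD v (f g : P) : evalp v (f + g) = evalp v f + evalp v g.
Proof. exact: mevalD. Qed.

Lemma evalpZ v c (f : P) : evalp v (c *: f) = c * evalp v f.
Proof. exact: mevalZ. Qed.

Lemma evalpX v j : evalp v ('X_j : P) = v 0 j.
Proof. exact: mevalXU. Qed.

Lemma evalp_sum v (I : Type) (s : seq I) Q (f : I -> P) :
  evalp v (\sum_(i <- s | Q i) f i) = \sum_(i <- s | Q i) evalp v (f i).
Proof. exact: raddf_sum. Qed.

Lemma evalp_in_ideal r (G : 'I_r -> P) v f :
  (forall i, evalp v (G i) = 0) -> in_ideal G f -> evalp v f = 0.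
Proof.
move=> Gv [h ->]; rewrite evalp_sum big1 // => i _.
by rewrite evalpM Gv mulr0.
Qed.

(** For fixed v with v_z != 0 and varying j, these linear forms generate the
    ideal of the point v.  The index j = z is kept, where the form is 0, to
    avoid a second index type. *)
Definition point_form v z j : P := 'X_j - (v 0 j / v 0 z) *: 'X_z.

Lemma evalp_point_form v z j w :
  evalp w (point_form v z j) = w 0 j - v 0 j / v 0 z * w 0 z.
Proof. by rewrite evalpB evalpZ !evalpX. Qed.

Lemma point_form_homog v z j : point_form v z j \is 1.-homog.
Proof.
have X1 i : ('X_i : P) \is 1.-homog by rewrite dhomogX /= mdeg1.
by rewrite rpredB // dhomogZ.
Qed.

Lemma point_form_base v z : v 0 z != 0 -> point_form v z z = 0.
Proof. by move=> vz; rewrite /point_form divff // scale1r subrr. Qed.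

Lemma point_form_vanish v z j : v 0 z != 0 -> evalp v (point_form v z j) = 0.
Proof. by move=> vz; rewrite evalp_point_form divfK // subrr. Qed.

Lemma point_form_separates v z w : v 0 z != 0 -> w != 0 -> ~ same_point v w ->
  exists j, evalp w (point_form v z j) != 0.
Proof.
move=> vz w0 vw; apply/existsP; apply: contra_notT vw => /existsPn y0.
have wE : w = (w 0 z / v 0 z) *: v.
  apply/rowP => j; have := y0 j; rewrite negbK evalp_point_form subr_eq0 !mxE.
  by move=> /eqP->; rewrite mulrC (mulrC (v 0 j)) mulrA.
exists (w 0 z / v 0 z); last exact: wE.
by apply: contraNneq w0 => c0; rewrite wE c0 scale0r eqxx.
Qed.

Lemma dhomog_split_point1 v z k (f : P) : f \is k.+1.-homog ->
  exists (q : 'I_m.+1 -> P) (g : P), [/\ forall j, q j \is k.-homog,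
    g \is k.-homog & f = \sum_j q j * point_form v z j + g * 'X_z].
Proof.
move=> /dhomog_split[q qh ->]; exists q, (\sum_j (v 0 j / v 0 z) *: q j).
split=> //; first by apply: dhomog_bigsum => j; apply: dhomogZ (qh j).
rewrite mulr_suml -big_split; apply: eq_bigr => j _ /=.
by rewrite /point_form mulrBr -scalerAr -scalerAl subrK.
Qed.

(** Modulo the ideal of the point v, every variable is a multiple of x_z. *)
Lemma dhomog_split_point v z k (f : P) : f \is k.+1.-homog ->
  exists (q : 'I_m.+1 -> P) (c : K), (forall j, q j \is k.-homog) /\
    f = \sum_j q j * point_form v z j + c *: 'X_z ^+ k.+1.
Proof.
elim: k f => [|k IH] f /(dhomog_split_point1 v z)[q [f' [qh f'h fE]]].
  exists q, f'@_0; split=> //.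
  by rewrite fE {1}(dhomog_const f'h) mul_mpolyC.
have [q' [c [qh' f'E]]] := IH _ f'h.
exists (fun j => q j + q' j * 'X_z), c; split=> [j|].
  have := dhomogM (qh' j) (dhomogXn K z 1); rewrite addn1 => qXh.
  exact: dhomogD.
rewrite fE f'E mulrDl addrA -scalerAl -exprSr mulr_suml -big_split /=.
by congr (_ + _); apply: eq_bigr => j _; rewrite mulrDl mulrAC.
Qed.

Lemma dhomog_split_vanishing v z k (f : P) :
  v 0 z != 0 -> f \is k.+1.-homog -> evalp v f = 0 ->
  exists q : 'I_m.+1 -> P, [/\ forall j, q j \is k.-homog, q z = 0 &
    f = \sum_j q j * point_form v z j].
Proof.
move=> vz /(dhomog_split_point v z)[q [c [qh fE]]] fv.
have sum0 : evalp v (\sum_j q j * point_form v z j) = 0.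
  by rewrite evalp_sum big1 // => j _; rewrite evalpM point_form_vanish ?mulr0.
have c0 : c = 0.
  have /eqP : c * v 0 z ^+ k.+1 = 0.
    by rewrite -[RHS]fv fE evalpD sum0 add0r evalpZ evalpXn evalpX.
  by rewrite mulf_eq0 expf_eq0 (negbTE vz) andbF orbF => /eqP.
exists (fun j => if j == z then 0 else q j); split=> [j||].
- by case: eqP => // _; apply: dhomog0.
- by rewrite eqxx.
rewrite fE c0 scale0r addr0; apply: eq_bigr => j _; case: eqP => // ->.
by rewrite point_form_base // !mulr0.
Qed.

(** The forms x_z and y_j (j != z) are obtained from the variables by a linear
    substitution U, and det (A U) is a multiple of det A, so the claim follows
    from [det_notin_ideal] for the matrix A U. *)
Lemma det_notin_ideal_point v z (F : 'I_m.+1 -> P) (A : 'M[P]_m.+1) :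
  (forall i, F i =
     \sum_j A i j * (if j == z then 'X_z else point_form v z j)) ->
  in_saturation F 1 -> ~ in_ideal F (\det A).
Proof.
set u := fun j => if j == z then 'X_z else point_form v z j.
pose w j l : P :=
  if (l == z) && (j != z) then (v 0 j / v 0 z)%:MP else 0.
pose U : 'M[P]_m.+1 := \matrix_(j, l) ((j == l)%:R - w j l).
have UE j : \sum_l U j l * 'X_l = u j.
  under eq_bigr => l _ do rewrite mxE mulrBl.
  rewrite sumrB (bigD1 j) //= eqxx mul1r big1 => [|l /negbTE]; last first.
    by rewrite eq_sym => ->; rewrite mul0r.
  rewrite addr0 (bigD1 z) //= /w eqxx big1 ?addr0 => [|l /negbTE->]; last first.
    by rewrite mul0r.
  rewrite /u; case: (eqVneq j z) => [->|_] /=; first by rewrite mul0r subr0.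
  by rewrite mul_mpolyC.
move=> FA F1 FdetA; apply: (@det_notin_ideal _ _ F (A *m U)) F1 _ => [i|].
  under [RHS]eq_bigr => j _ do rewrite mxE mulr_suml.
  rewrite exchange_big FA; apply: eq_bigr => l _ /=.
  rewrite -/(u l) -UE mulr_sumr.
  by apply: eq_bigr => j _; rewrite mulrA.
by rewrite det_mulmx mulrC; apply: in_idealMl.
Qed.

End PointForms.

(** * The Cayley-Bacharach property *)

Section CayleyBacharach.
Variables (K : finFieldType) (m : nat).
Notation P := {mpoly K[m.+1]}.

Lemma expf_pred_card (x : K) k : x != 0 -> x ^+ (k * #|K|.-1) = 1.
Proof.
move=> x0; rewrite mulnC exprM (_ : x ^+ _ = 1) ?expr1n //.
apply: (mulfI x0); rewrite -exprS prednK ?expf_card ?mulr1 //.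
exact: ltnW (card_finNzRing_gt1 K).
Qed.

Lemma pred_card_gt0 : (0 < #|K|.-1)%N.
Proof. by have := card_finNzRing_gt1 K; case: #|K| => [|[]]. Qed.

(** The power L of f_0 takes the value 1 on Gamma, and so does x_j^b wherever
    x_j is nonzero, b being the degree of L.  Hence x_j^(b+q-1) - L x_j^(q-1)
    vanishes on Gamma, and after multiplication with a power of x_j it lies in
    (G).  Here q is the number of elements of K; the factor x_j^(q-1) takes care
    of the points where x_j is 0, as b may be 0. *)
Lemma cons_form_saturation_full n (p : 'I_n -> 'rV[K]_m.+1) (G : 'I_m -> P)
    (f0 : P) a t :
  defines_reduced G p -> f0 \is (a).-homog -> (forall i, evalp (p i) f0 != 0) ->
  in_saturation (cons_form (f0 ^+ (t * #|K|.-1)) G) 1.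
Proof.
move=> Gp f0h f0p j; set L := f0 ^+ _; set Q := #|K|.-1.
have Q0 : (0 < Q)%N := pred_card_gt0.
pose b := (a * (t * Q))%N.
pose W : P := 'X_j ^+ (b + Q) - L * 'X_j ^+ Q.
have Wh : W \is (b + Q).-homog.
  apply: rpredB; first exact: dhomogXn.
  by apply: dhomogM (dhomogXn _ _ _); apply: dhomogMn.
have Wp : vanishes_on p W.
  move=> i.
  rewrite evalpB evalpM !evalpXn evalpX expf_pred_card // mul1r exprD.
  have [->|x0] := eqVneq (p i 0 j) 0; last first.
    by rewrite /b mulnA expf_pred_card // mul1r subrr.
  by rewrite (_ : 0 ^+ Q = 0) ?mulr0 ?subrr // expr0n eqn0Ngt Q0.
have [N NW] := (Gp _ _ Wh).2 Wp j.
exists (N + (b + Q))%N; rewrite mulr1.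
rewrite exprD -['X_j ^+ (b + Q)](subrK (L * 'X_j ^+ Q)) -/W mulrDr.
apply: in_idealD; first exact: in_ideal_consr.
by rewrite mulrCA mulrC; apply: in_ideal_consl.
Qed.

(** If g(p i0) were nonzero, a multiple of g x_z^(k+1) would agree with the form
    Delta below on all points.  In x_z^b g x_z^(k+1) the power x_z^(b+1) can be
    exchanged for the form L of degree b + 1, as both take the value 1 at p i0
    and g vanishes at the other points.  For large b this puts x_z^b Delta into
    the ideal (L, G), which [det_notin_ideal_point] forbids. *)
Lemma cayley_bacharach (d : 'I_m -> nat) n (p : 'I_n -> 'rV[K]_m.+1)
    (G : 'I_m -> P) (f0 : P) a (g : P) e i0 :
  proj_points p -> (forall i, 0 < d i)%N ->
  (forall i, G i \is (d i).-homog) -> defines_reduced G p ->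
  (0 < a)%N -> f0 \is (a).-homog -> (forall i, evalp (p i) f0 != 0) ->
  g \is e.-homog -> (e < \sum_i (d i).-1)%N ->
  (forall i, i != i0 -> evalp (p i) g = 0) -> evalp (p i0) g = 0.
Proof.
move=> [p0 pinj] d_gt0 Gh Gp a0 f0h f0p gh eD gp; apply/eqP/negPn/negP => gp0.
have [z pz] := row_nonzero_coord (p0 i0).
pose y := point_form (p i0) z.
have Gp0 i j : evalp (p j) (G i) = 0.
  exact: (Gp _ _ (Gh i)).1 (in_saturation_gen G i) j.
have /fin_all_exists[A AG] i : exists q : 'I_m.+1 -> P,
    [/\ forall j, q j \is ((d i).-1).-homog, q z = 0 & G i = \sum_j q j * y j].
  by apply: dhomog_split_vanishing => //; rewrite prednK.
have Az i : A i z = 0 by have [] := AG i.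
(* The column z of A is 0 and is left out: G = A y is a square system. *)
pose Delta : P := (-1) ^+ z * \det (\matrix_(i, j) A i (lift z j)).
have Dh : Delta \is (\sum_i (d i).-1).-homog.
  rewrite /Delta -signr_odd mulr_sign.
  case: ifP => _; rewrite ?dhomogN; apply: dhomog_det => i j;
    by rewrite mxE; have [] := AG i.
have detE bd : \det (bordered bd A) = bd z * Delta by apply: det_bordered.
clearbody Delta.
have Dy j : in_ideal G (Delta * y j).
  have := detE (fun k => (k == z)%:R); rewrite eqxx mul1r => <-.
  rewrite cramer; apply: in_ideal_sum => i _; apply: in_idealMl.
  rewrite bordered_mul /cons_form; case: (unlift _ _) => [i'|].
    by have [_ _ <-] := AG i'; apply: in_ideal_gen.
  rewrite (bigD1 z) //= big1 ?addr0 => [|k /negbTE->]; last by rewrite mul0r.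
  by rewrite /y point_form_base // mulr0 -(mul0r (0 : P)); exists (fun=> 0);
     rewrite mul0r big1 // => k _; rewrite mul0r.
(* Some y_j is nonzero at p i, whereas Delta y_j, being in (G), is 0 there. *)
have Dp i : i != i0 -> evalp (p i) Delta = 0.
  move=> ii0; have [|j yj] := point_form_separates pz (p0 i).
    by move/pinj/esym/eqP; rewrite (negbTE ii0).
  have /eqP := evalp_in_ideal (Gp0^~ i) (Dy j).
  by rewrite evalpM mulf_eq0 (negbTE yj) orbF => /eqP.
have [k kE] : exists k, (\sum_i (d i).-1 = e + k.+1)%N.
  exists (\sum_i (d i).-1 - e.+1)%N; by rewrite addnS -addSn subnKC.
pose c := evalp (p i0) Delta / (evalp (p i0) g * p i0 0 z ^+ k.+1).
pose e1 := Delta - c *: (g * 'X_z ^+ k.+1).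
have e1h : e1 \is (\sum_i (d i).-1).-homog.
  apply: rpredB => //; apply: dhomogZ; rewrite kE.
  exact: dhomogM (dhomogXn _ _ _).
have e1E i : evalp (p i) e1 =
    evalp (p i) Delta - c * (evalp (p i) g * p i 0 z ^+ k.+1).
  by rewrite evalpB evalpZ evalpM evalpXn evalpX.
have e1p : vanishes_on p e1.
  move=> i; rewrite e1E; have [->|ii0] := eqVneq i i0.
    by rewrite divfK ?subrr // mulf_neq0 // expf_neq0.
  by rewrite Dp // gp // mul0r mulr0 subrr.
have [N1 N1P] := in_saturation_high_degree ((Gp _ _ e1h).2 e1p).
have /fin_all_exists[N2 N2P] j : exists N, forall k q, (N <= k)%N ->
    q \is k.-homog -> in_ideal G (q * (y j * g)).
  have yh : y j * g \is (1 + e).-homog.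
    exact: dhomogM (point_form_homog _ _ _) gh.
  apply/in_saturation_high_degree/(Gp _ _ yh) => i.
  rewrite evalpM; have [->|ii0] := eqVneq i i0; last by rewrite gp ?mulr0.
  by rewrite point_form_vanish ?mul0r.
(* The degree b + 1 of L must exceed all the bounds N1 and N2 j. *)
pose t := (N1 + \sum_j N2 j).+1; pose Q := #|K|.-1.
have Q0 : (0 < Q)%N := pred_card_gt0.
have [b bE] : exists b, (a * (t * Q) = b.+1)%N.
  by exists (a * (t * Q)).-1; rewrite prednK // !muln_gt0 a0 Q0.
have tb : (N1 + \sum_j N2 j <= b)%N.
  by rewrite -ltnS -bE -/t mulnCA leq_pmulr // muln_gt0 a0.
pose L := f0 ^+ (t * Q).
have Lh : L \is b.+1.-homog by rewrite -bE; apply: dhomogMn.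
have [q [qh qz LE]] : exists q : 'I_m.+1 -> P, [/\ forall j, q j \is b.-homog,
    q z = 0 & L - 'X_z ^+ b.+1 = \sum_j q j * y j].
  apply: dhomog_split_vanishing => //.
    by apply: rpredB => //; apply: dhomogXn.
  by rewrite evalpB !evalpXn evalpX -bE mulnA !expf_pred_card // subrr.
pose F := cons_form L G.
pose bd (j : 'I_m.+1) : P := if j == z then 'X_z ^+ b else q j.
apply: (@det_notin_ideal_point _ _ (p i0) z F (bordered bd A)).
- move=> i; rewrite bordered_mul /F /cons_form.
  case: (unlift _ _) => [i'|].
    have [_ _ ->] := AG i'; apply: eq_bigr => j _.
    by case: eqP => // ->; rewrite Az !mul0r.
  rewrite (bigD1 z) //= /bd eqxx -exprSr.
  rewrite -[LHS](subrK ('X_z ^+ b.+1)) LE addrC (bigD1 z) //= qz mul0r add0r.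
  by congr (_ + _); apply: eq_bigr => j /negbTE->.
- exact: (cons_form_saturation_full _ Gp f0h f0p).
rewrite detE /bd eqxx.
have -> : 'X_z ^+ b * Delta = 'X_z ^+ b * e1 + (c *: (g * 'X_z ^+ k)) * L
    - \sum_j (c%:MP * 'X_z ^+ k * q j) * (y j * g).
  have -> : \sum_j c%:MP * 'X_z ^+ k * q j * (y j * g) =
      c%:MP * 'X_z ^+ k * g * (L - 'X_z ^+ b.+1).
    rewrite LE mulr_sumr; apply: eq_bigr => j _.
    by rewrite -!mulrA; do 2 congr (_ * _); rewrite mulrA mulrC.
  rewrite /e1 -!mul_mpolyC !exprS; move: c%:MP => cc; move: ('X_z : P) => X.
  by ring.
apply: in_idealD; [apply: in_idealD|].
- apply: in_ideal_consr; apply: N1P (dhomogXn _ _ _).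
  exact: leq_trans (leq_addr _ _) tb.
- exact: in_ideal_consl.
rewrite -mulN1r; apply/in_idealMl/in_ideal_sum => j _.
have -> : c%:MP * 'X_z ^+ k * q j * (y j * g) =
    c%:MP * ((q j * 'X_z ^+ k) * (y j * g)) by ring.
apply/in_ideal_consr/in_idealMl/(N2P _ (b + k)%N).
  apply: leq_trans (leq_addr _ _); apply: leq_trans tb.
  by rewrite (bigD1 j) //= addnCA leq_addr.
exact: dhomogM (dhomogXn _ _ k).
Qed.

End CayleyBacharach.

(** * The weight of a codeword *)

Section CodeBound.
Variables (K : finFieldType) (m : nat).
Notation P := {mpoly K[m.+1]}.

Lemma separating_linear_form n (p : 'I_n -> 'rV[K]_m.+1) i i0 :
  proj_points p -> i != i0 -> exists l : P,
    [/\ l \is 1.-homog, evalp (p i) l = 0 & evalp (p i0) l != 0].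
Proof.
move=> [p0 pinj] ii0.
have [z pz] := row_nonzero_coord (p0 i).
have [|j yj] := point_form_separates pz (p0 i0).
  by move/pinj/eqP; rewrite (negbTE ii0).
exists (point_form (p i) z j); split=> //; first exact: point_form_homog.
exact: point_form_vanish.
Qed.

(** Multiplying f with one linear form for each point other than p i0 at which
    f is nonzero gives a form that is nonzero at p i0 only;
    [cayley_bacharach] bounds its degree from below. *)
Lemma nonzeros_bound (d : 'I_m -> nat) n (p : 'I_n -> 'rV[K]_m.+1)
    (G : 'I_m -> P) (f0 f : P) a i0 :
  proj_points p -> (forall i, 0 < d i)%N ->
  (forall i, G i \is (d i).-homog) -> defines_reduced G p ->
  (0 < a)%N -> f0 \is (a).-homog -> (forall i, evalp (p i) f0 != 0) ->
  f \is (a).-homog -> evalp (p i0) f != 0 ->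
  (\sum_i (d i).-1 < a + #|[set i | evalp (p i) f != 0%R]|)%N.
Proof.
move=> pp d_gt0 Gh Gp a0 f0h f0p fh fp0.
set S := [set i | _].
have /fin_all_exists[l lP] i : exists l : P, i != i0 ->
    [/\ l \is 1.-homog, evalp (p i) l = 0 & evalp (p i0) l != 0].
  have [->|ii0] := eqVneq i i0; first by exists 0.
  by have [l lP] := separating_linear_form pp ii0; exists l.
pose h := \prod_(i in S :\ i0) l i.
have hh : h \is #|S :\ i0|.-homog.
  rewrite -sum1_card /h.
  apply: (big_rec2 (fun (f : P) k => f \is k.-homog)); first exact: dhomog1.
  move=> i k g; rewrite !inE => /andP[ii0 _] gh.
  by have [lh _ _] := lP i ii0; apply: dhomogM.
have hp i : i \in S :\ i0 -> evalp (p i) h = 0.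
  move=> iS; rewrite /h (bigD1 i) //= evalpM.
  by move: iS; rewrite !inE => /andP[/lP[_ -> _] _]; rewrite mul0r.
have hp0 : evalp (p i0) h != 0.
  rewrite /h; apply: (big_ind (fun g : P => evalp (p i0) g != 0)).
  - by rewrite /evalp meval1 oner_neq0.
  - by move=> g g' g0 g'0; rewrite evalpM mulf_neq0.
  - by move=> i; rewrite !inE => /andP[/lP[]].
rewrite ltnNge; apply: contraNN (mulf_neq0 fp0 hp0) => le_aS.
rewrite -evalpM; apply/eqP.
apply: (cayley_bacharach (e := (a + #|S :\ i0|)%N) pp d_gt0 Gh Gp a0 f0h f0p).
- exact: dhomogM.
- apply: leq_trans le_aS.
  by rewrite (cardsD1 i0 S) inE fp0 addnA addn1 ltn_add2r.
move=> i ii0; rewrite evalpM.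
have [iS|] := boolP (i \in S); first by rewrite hp ?mulr0 // in_setD1 ii0.
by rewrite inE negbK => /eqP->; rewrite mul0r.
Qed.

End CodeBound.

Theorem theorem3p2 (K : finFieldType) (m : nat) (d : 'I_m -> nat) (n : nat)
    (p : 'I_n -> 'rV[K]_m.+1) (a : nat) (f0 : {mpoly K[m.+1]}) :
  (1 <= m)%N ->
  proj_points p ->
  reduced_complete_intersection d p ->
  f0 \is (a).-homog ->
  (forall i, evalp (p i) f0 != 0) ->
  let D : int := \sum_(i < m) (d i)%:Z in
  let s : int := D - m%:Z - 1 in
  1 <= a%:Z <= s ->
  D - a%:Z - (m%:Z - 1) <= (min_distance (eval_code a p f0))%:Z /\
  D - a%:Z - (m%:Z - 1) = s - a%:Z + 2.
Proof.
move=> _ pp [d_gt0 [G [Gh Gp]]] f0h f0p D s /andP[a_gt0 _].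
split; last by rewrite /s; ring.
(* Without points the code would be 0 and its minimum distance n = 0. *)
have i0 : 'I_n.
  case: n p pp f0p Gp => [|n] p _ _ Gp; last exact: ord0.
  exfalso; apply: (complete_intersection_nonempty d_gt0 Gh).
  by apply/(Gp _ _ (dhomog1 _ _)); case.
(* The word of f0 is constant 1, so the code has a word of minimum weight. *)
pose f0' := DHomog f0h.
have word0 : eval_word p f0 f0' 0 i0 = 1 by rewrite mxE divff.
have code0 : eval_code a p f0 != 0%VS.
  apply: contraTneq (oner_neq0 K) => C0.
  have : eval_word p f0 f0' \in eval_code a p f0.
    by apply/eval_codeP; exists f0'.
  by rewrite C0 memv0 -word0 => /eqP->; rewrite mxE eqxx.
have [[c [/eval_codeP[f cE] c0 <-]] _] := min_distanceP code0.
have [i1 ci1] := row_nonzero_coord c0.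
have supp i : (c 0 i != 0) = (evalp (p i) f != 0).
  by rewrite cE mxE mulf_eq0 invr_eq0 (negbTE (f0p i)) orbF.
have := nonzeros_bound pp d_gt0 Gh Gp a_gt0 f0h f0p (dhomog_is_dhomog f).
move=> /(_ i1); rewrite -supp => /(_ ci1).
under eq_finset => i do rewrite -supp.
rewrite -/(weight c).
have -> : D = (\sum_i (d i).-1 + m)%N.
  rewrite -[X in (_ + X)%N]card_ord -sum1_card -big_split /D.
  rewrite -(big_morph _ PoszD (erefl _)).
  by congr Posz; apply: eq_bigr => i _ /=; rewrite addn1 prednK.
by move=> dw; lia.
Qed.
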